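(* Let $\{C_n^{\mathrm{enc}}\}_{n\in\mathbb{N}}$ be a monotone affinely encoded manifold spectrum, $C_n^{\mathrm{enc}}:=\pi-\epsilon\,\lambda_n(-\Delta_g)$ with $\epsilon>0$, such that $C_n^{\mathrm{enc}}<\pi$ for all $n$, and suppose that $$C_n^{\mathrm{enc}}\sim\pi-\kappa\,n^{2/d},\qquad n\to\infty,$$ for some constant $\kappa>0$ and parameter $d>0$. Then the associated encoded density $\rho_{\mathrm{enc}}$ satisfies, up to a positive multiplicative constant, $$\rho_{\mathrm{enc}}(C)\sim(\pi-C)^{(d-2)/2},\qquad C\to-\infty,$$ and, within the class of encoded spectra with such asymptotics, the exponent of this law determines the effective geometric dimension $d$. Conversely, any monotone encoded spectrum whose density has such behavior satisfies $$C_n^{\mathrm{enc}}\sim\pi-\widetilde\kappa\,n^{2/d},\qquad n\to\infty,$$ for some $\widetilde\kappa>0$.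
   Context: Here $\lambda_n(-\Delta_g)$ are Laplace–Beltrami eigenvalues of a compact Riemannian manifold $(M,g)$, counted with multiplicity in nondecreasing order, so $C_n^{\mathrm{enc}}$ is nonincreasing; since $C_n^{\mathrm{enc}}<\pi$ is required, the indices $n\in\mathbb{N}$ run over the positive eigenvalues. The counting function is $N_{\mathrm{enc}}(C):=\#\{n: C_n^{\mathrm{enc}}\ge C\}$ and the encoded density is $\rho_{\mathrm{enc}}(C):=-\frac{d}{dC}N_{\mathrm{enc}}(C)$, with derivative and asymptotics understood in the distributional (Stieltjes) sense. The relation $C_n^{\mathrm{enc}}\sim\pi-\kappa n^{2/d}$ means $(\pi-C_n^{\mathrm{enc}})/(\kappa n^{2/d})\to1$. *)

(* Defs.v *)
From HB Require Import structures.
From mathcomp Require Import all_boot all_order all_algebra.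
From mathcomp Require Import all_classical all_reals all_analysis.

Set Implicit Arguments.
Unset Strict Implicit.
Unset Printing Implicit Defensive.

Import Order.TTheory GRing.Theory Num.Theory.
Import numFieldNormedType.Exports.

Local Open Scope classical_set_scope.
Local Open Scope ring_scope.

Section SmoothFunctions.
Context {R : realType} {m : nat}.

Definition partial (a : 'I_m) (f : 'rV[R]_m -> R) : 'rV[R]_m -> R :=
  fun x => 'D_(delta_mx 0 a) f x.

(* Meant for open U: continuity and partial derivatives at the points of U
   are then insensitive to the values of f outside U. *)
Fixpoint class_C (k : nat) (U : set 'rV[R]_m) (f : 'rV[R]_m -> R) : Prop :=
  (forall x, U x -> {for x, continuous f}) /\
  (if k is k'.+1 then
     forall a : 'I_m,
       (forall x, U x -> derivable f x (delta_mx 0 a)) /\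
       class_C k' U (partial a f)
   else True).

Definition smooth_on (U : set 'rV[R]_m) (f : 'rV[R]_m -> R) : Prop :=
  forall k, class_C k U f.

(* The Laplace-Beltrami operator in local coordinates,
   det(G)^(-1/2) * sum_a d_a (det(G)^(1/2) * sum_b G^(ab) * d_b u). *)
Definition local_laplacian (G : 'rV[R]_m -> 'M[R]_m) (u : 'rV[R]_m -> R)
    (x : 'rV[R]_m) : R :=
  (Num.sqrt (\det (G x)))^-1 *
  \sum_(a < m) partial a (fun y =>
    Num.sqrt (\det (G y)) * \sum_(b < m) invmx (G y) a b * partial b u y) x.

End SmoothFunctions.

(* A closed (compact, without boundary) smooth Riemannian manifold of dimension
   m, presented by a smooth atlas.  [param i] is the inverse of [chart i];
   [chart i] and [param i] are total functions whose values outside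
   [chart_dom i] and [chart i @` chart_dom i] are irrelevant.  [metric i] is the
   Gram matrix of the metric in the coordinates [chart i].  The space is
   automatically second countable, being compact and locally Euclidean. *)
Record closedRiemannianManifold (R : realType) (m : nat) :=
  ClosedRiemannianManifold {
  points :> topologicalType ;
  chart_index : Type ;
  chart_dom : chart_index -> set points ;
  chart : chart_index -> points -> 'rV[R]_m ;
  param : chart_index -> 'rV[R]_m -> points ;
  metric : chart_index -> 'rV[R]_m -> 'M[R]_m ;
  manifold_compact : compact [set: points] ;
  manifold_hausdorff : hausdorff_space points ;
  chart_cover : forall p, exists i, chart_dom i p ;
  chart_dom_open : forall i, open (chart_dom i) ;
  chart_img_open : forall i, open (chart i @` chart_dom i) ;
  chartK : forall i p, chart_dom i p -> param i (chart i p) = p ;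
  chart_continuous : forall i p, chart_dom i p ->
    {for p, continuous (chart i)} ;
  param_continuous : forall i x, (chart i @` chart_dom i) x ->
    {for x, continuous (param i)} ;
  transition_smooth : forall i j (c : 'I_m),
    smooth_on (chart i @` (chart_dom i `&` chart_dom j))
              (fun x => chart j (param i x) 0 c) ;
  metric_smooth : forall i (a b : 'I_m),
    smooth_on (chart i @` chart_dom i) (fun x => metric i x a b) ;
  metric_sym : forall i x, (chart i @` chart_dom i) x ->
    (metric i x)^T = metric i x ;
  metric_posdef : forall i x, (chart i @` chart_dom i) x ->
    forall v : 'rV[R]_m, v != 0 -> 0 < (v *m metric i x *m v^T) 0 0 ;
  metric_compat : forall i j p, chart_dom i p -> chart_dom j p ->
    forall a b : 'I_m,
      metric i (chart i p) a b =
      \sum_(c < m) \sum_(e < m)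
        partial a (fun x => chart j (param i x) 0 c) (chart i p) *
        partial b (fun x => chart j (param i x) 0 e) (chart i p) *
        metric j (chart j p) c e }.

Section Spectrum.
Context {R : realType} {m : nat} (M : closedRiemannianManifold R m).

Definition smooth_function (f : M -> R) : Prop :=
  forall i : chart_index M,
    smooth_on (chart i @` chart_dom i) (fun x => f (param i x)).

(* f is smooth and - Delta_g f = mu f; f = 0 is allowed. *)
Definition laplace_eigenfunction (mu : R) (f : M -> R) : Prop :=
  smooth_function f /\
  forall (i : chart_index M) (p : M), chart_dom i p ->
    - local_laplacian (metric i) (fun x => f (param i x)) (chart i p) = mu * f p.

(* lam 0 <= lam 1 <= ... lists the positive eigenvalues of - Delta_g, each
   repeated according to its multiplicity: for every mu > 0 the phi n with
   lam n = mu form a basis of the eigenspace of mu. *)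
Definition positive_laplace_spectrum (lam : nat -> R) : Prop :=
  [/\ nondecreasing_seq lam,
      forall n, 0 < lam n &
      exists phi : nat -> M -> R,
        [/\ forall n, laplace_eigenfunction (lam n) (phi n),
            forall (N : nat) (a : nat -> R),
              (forall p, \sum_(k < N) a k * phi k p = 0) ->
              forall k, (k < N)%N -> a k = 0 &
            forall (mu : R) (f : M -> R), 0 < mu ->
              laplace_eigenfunction mu f ->
              exists (N : nat) (a : nat -> R), forall p,
                f p = \sum_(k < N | lam k == mu) a k * phi k p]].

End Spectrum.

Section EncodedSpectra.
Context {R : realType}.

Definition encoded (eps : R) (lam : nat -> R) : nat -> R :=
  fun n => pi - eps * lam n.

(* C n is the (n+1)-st term of the spectrum, which is numbered from 1. *)
Definition encoded_asymptotics (C : nat -> R) (kappa d : R) : Prop :=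
  (pi - C n) / (kappa * n.+1%:R `^ (2 / d)) @[n --> \oo] --> (1 : R).

Definition enc_counting (C : nat -> R) (x : R) : \bar R :=
  counting [set n | x <= C n].

(* rho = - dN as a Lebesgue-Stieltjes measure, N being the counting function;
   the intervals are closed on the left because N is left-continuous. *)
Definition encoded_density (C : nat -> R)
    (rho : {measure set (measurableTypeR R) -> \bar R}) : Prop :=
  (forall x, enc_counting C x \is a fin_num) /\
  (forall a b : R, a <= b ->
     rho `[a, b[%classic = (enc_counting C a - enc_counting C b)%E).

(* rho(x) ~ f(x) as x --> -oo in the Stieltjes sense, i.e. for the masses
   accumulated below pi, where the spectrum lies. *)
Definition stieltjes_equiv (rho : {measure set (measurableTypeR R) -> \bar R})
    (f : R -> R) : Prop :=
  fine (rho `[x, pi[%classic) /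
    Rintegral lebesgue_measure `[x, pi[%classic f @[x --> -oo]
    --> (1 : R).

Definition power_law (rho : {measure set (measurableTypeR R) -> \bar R})
    (alpha : R) : Prop :=
  exists2 c : R, 0 < c & stieltjes_equiv rho (fun x => c * (pi - x) `^ alpha).

End EncodedSpectra.

(* Main.v *)
(* With s n = ((pi - C n) / kappa)^(d/2), the spectral asymptotics says that
   s n ~ n + 1, and the counting function of C at x is the counting function of
   s at y = ((pi - x) / kappa)^(d/2).  For a nondecreasing positive sequence,
   s n ~ n + 1 holds if and only if #{n : s n <= y} ~ y.  Since the density has
   mass N(x) on [x, pi[ and int_x^pi c (pi - u)^alpha du is
   c (pi - x)^(alpha + 1) / (alpha + 1), both implications of the theorem are
   this equivalence with alpha + 1 = d / 2.  When alpha <= -1 the integral is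
   infinite and its real value is the junk value 0, so no such power law holds;
   when alpha > -1 the power of pi - x is read off the growth of N. *)

Require Import Defs.
From HB Require Import structures.
From mathcomp Require Import all_boot all_order all_algebra.
From mathcomp Require Import all_classical all_reals all_analysis.
From mathcomp Require Import measurable_realfun ring lra.

Set Implicit Arguments.
Unset Strict Implicit.
Unset Printing Implicit Defensive.

Import Order.TTheory GRing.Theory Num.Theory.
Import numFieldNormedType.Exports.

Local Open Scope classical_set_scope.
Local Open Scope ring_scope.

(** * Limits and integrals of real powers *)

Lemma cvg_powR (R : realType) (T : Type) (F : set_system T) {FF : Filter F}
    (f : T -> R) (l p : R) :
  0 < l -> f x @[x --> F] --> l -> f x `^ p @[x --> F] --> l `^ p.
Proof.
move=> l0 fl.
suff H : {for l, continuous (fun x : R => x `^ p)} 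
  by exact: (cvg_comp _ _ fl H).
have /@ex_derive/derivable1_diffP := is_derive1_powR p l0.
exact: differentiable_continuous.
Qed.

Lemma cvgry_powR (R : realType) (p : R) : 0 < p -> x `^ p @[x --> +oo] --> +oo.
Proof.
move=> p0; apply/cvgryPge => A; near=> x.
have Ax : `|A| `^ p^-1 <= x by near: x; exact: nbhs_pinfty_ge.
have := ge0_ler_powR (ltW p0) (powR_ge0 _ _ : _ \in Num.nneg)
          (le_trans (powR_ge0 _ _) Ax : _ \in Num.nneg) Ax.
rewrite -powRrM mulVf ?gt_eqF// powRr1//; exact: (le_trans (ler_norm _)).
Unshelve. all: by end_near. Qed.

Lemma is_derive_powR_subl (R : realType) (b p x : R) : p + 1 != 0 -> x < b ->
  is_derive x 1 (fun u => - ((b - u) `^ (p + 1) / (p + 1)))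
    ((b - x) `^ p).
Proof.
move=> p0 xb.
have bx : 0 < b - x by rewrite subr_gt0.
have H : is_derive x 1 (fun u : R => b - u) (-1).
  by apply: is_derive_eq; rewrite add0r mul1r.
have H2 := @is_derive1_comp _ (fun u : R => u `^ (p + 1))
  (fun u : R => b - u) x _ _ (is_derive1_powR (p + 1) bx) H.
have H3 : is_derive x 1 (fun u : R => (p + 1)^-1 *: (b - u) `^ (p + 1))
   ((p + 1)^-1 *: ((p + 1) * (b - x) `^ (p + 1 - 1) * -1)).
  exact: is_deriveZ.
have -> : (fun u : R => - ((b - u) `^ (p + 1) / (p + 1))) =
          - (fun u : R => (p + 1)^-1 *: (b - u) `^ (p + 1)).
  by apply/funext => u; rewrite /= -[RHS]/(- _) /GRing.scale/= mulrC.
apply: is_derive_eq.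
by rewrite /GRing.scale/= addrK; field.
Qed.

Lemma integral_powR_itvcc (R : realType) (a c b p : R) : a < c -> c < b -> -1 < p ->
  (\int[lebesgue_measure]_(u in `[a, c]) ((b - u) `^ p)%:E =
   ((b - a) `^ (p + 1) / (p + 1) - (b - c) `^ (p + 1) / (p + 1))%:E)%E.
Proof.
move=> ac cb p1.
have p0 : p + 1 != 0 by rewrite gt_eqF// -ltrBlDr sub0r.
have D x := @is_derive_powR_subl _ b p x p0.
have C x : x < b -> {for x, continuous (fun u => - ((b - u) `^ (p + 1) / (p + 1)))}.
  move=> /D/@ex_derive/derivable1_diffP; exact: differentiable_continuous.
rewrite (@continuous_FTC2 _ _ (fun u => - ((b - u) `^ (p + 1) / (p + 1))))//.
- by rewrite -EFinB opprK addrC.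
- apply: continuous_in_subspaceT => x /[!inE]/= /[!in_itv]/= /andP[_ xc].
  apply: cvg_powR; first by rewrite subr_gt0 (le_lt_trans xc).
  by apply: cvgB; [exact: cvg_cst|exact: cvg_id].
- split.
  + move=> x /[!in_itv]/= /andP[_ xc].
    by have [] := D x (lt_trans xc cb).
  + by apply: cvg_at_right_filter; exact: (C _ (lt_trans ac cb)).
  + by apply: cvg_at_left_filter; exact: C.
- move=> x /[!in_itv]/= /andP[_ xc].
  by rewrite derive1E; have [_ ->] := D x (lt_trans xc cb).
Qed.

Lemma measurable_powR_subl (R : realType) (b p : R) (A : set R) :
  measurable_fun A (fun u : R => (b - u) `^ p).
Proof.
apply: measurable_funTS; apply: (measurableT_comp (measurable_powR p)).
exact: measurable_funB.
Qed.

(** For p < 0 the integrand blows up at [b], so the value is obtained by monotone convergence along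
    intervals [[a, c n]] exhausting [[a, b[]. The boundary term at [c n] vanishes in the limit
    because p + 1 > 0. *)
Lemma integral_powR_itvco (R : realType) (a b p : R) : a < b -> -1 < p ->
  (\int[lebesgue_measure]_(u in `[a, b[) ((b - u) `^ p)%:E =
   ((b - a) `^ (p + 1) / (p + 1))%:E)%E.
Proof.
move=> ab p1.
have ba0 : 0 < b - a by rewrite subr_gt0.
have p0 : 0 < p + 1 by rewrite -ltrBlDr sub0r.
(* The shift of the index ensures [a < c 0]: as [harmonic 0] is 1, the unshifted sequence would
   start at [a]. *)
pose c (n : nat) : R := b - (b - a) * harmonic n.+1.
have h1 n : @harmonic R n.+1 < 1 by rewrite invf_lt1// ltr1n.
have -> : `[a, b[%classic = \bigcup_n `[a, c n]%classic.
  apply/seteqP; split=> [x /=|x [n _ /=]]; rewrite !in_itv/= => /andP[ax].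
    move=> xb.
    have [n _ /(_ n (leqnn n))] := ((cvgrPdist_lt _ _).1 (@cvg_harmonic R))
      ((b - x) / (b - a)) (divr_gt0 (etrans (subr_gt0 _ _) xb : 0 < _) ba0).
    rewrite /= sub0r normrN ger0_norm ?harmonic_ge0// ltr_pdivlMr// => hn.
    exists n => //=; rewrite in_itv/= ax /c lerBrDr -lerBrDl.
    rewrite (le_trans _ (ltW hn))// mulrC ler_pM2r//.
    by rewrite lef_pV2 ?posrE// ler_nat.
  move=> xc; rewrite ax (le_lt_trans xc)// /c ltrBlDr ltrDl.
  by rewrite mulr_gt0// harmonic_gt0.
have mc n : a < c n /\ c n < b.
  rewrite /c; split; last by rewrite ltrBlDr ltrDl mulr_gt0// harmonic_gt0.
  by rewrite ltrBrDr -ltrBrDl -[ltRHS]mulr1 ltr_pM2l.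
have F := @ge0_nondecreasing_set_cvg_integral _ (measurableTypeR R) R
  (fun n => `[a, c n]%classic) (fun u : R => ((b - u) `^ p)%:E) (@lebesgue_measure R).
apply: (cvg_unique _ (F _ _ _ _)) => //=.
- apply/nondecreasing_seqP => n; rewrite subsetEset; apply: subset_itvl.
  rewrite bnd_simp /c lerB// ler_wpM2l ?(ltW ba0)// /harmonic.
  by rewrite lef_pV2 ?posrE// ler_nat.
- move=> i; apply/measurable_EFinP; exact: measurable_powR_subl.
- by move=> i x _; rewrite lee_fin powR_ge0.
under eq_cvg do rewrite integral_powR_itvcc ?(mc _).1 ?(mc _).2//.
apply: cvg_EFin; first exact: nearW.
rewrite -[X in _ --> X]subr0 -(mul0r (p + 1)^-1); apply: cvgB; first exact: cvg_cst.
apply: cvgM; last exact: cvg_cst.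
apply: ((cvg_at_rightP _ _ _).1 (powR_cvg0 p0)).
split=> [n|]; first by rewrite subr_gt0 (mc n).2.
rewrite /c; under eq_fun do rewrite opprB addrC subrK.
rewrite -(mulr0 (b - a)); apply: cvgM; first exact: cvg_cst.
rewrite (cvg_shiftS (@harmonic R)); exact: cvg_harmonic.
Qed.

(* Near b the integrand dominates (b - u) `^ (e - 1) for every e in ]0, 1], whose
   integral is of order 1 / e. *)
Lemma integral_powR_itvco_pinfty (R : realType) (a b p : R) : a < b -> p <= -1 ->
  (\int[lebesgue_measure]_(u in `[a, b[) ((b - u) `^ p)%:E = +oo)%E.
Proof.
move=> ab p1; apply: eq_infty => r.
(* On [[a', b[] the base b - u is at most 1, so lowering the exponent does not lower the power. *)
pose a' := Num.max a (b - 1).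
have aa' : a <= a' by rewrite le_max lexx.
have a'b : a' < b by rewrite gt_max ab ltrBlDr ltrDl ltr01.
have ba' : b - a' <= 1 by rewrite lerBlDr addrC -lerBlDr le_max lexx orbT.
(* Chosen so that (b - a') / e = |r| + 1. Since b - a' and [e] are at most 1, the integral (b -
   a')^e / e is at least this. *)
pose e := (b - a') / (`|r| + 1).
have r0 : 0 < `|r| + 1 by rewrite ltr_wpDl.
have e0 : 0 < e by rewrite divr_gt0// subr_gt0.
have e1 : e <= 1.
  by rewrite ler_pdivrMr// mul1r (le_trans ba')// lerDr.
apply: (@le_trans _ _ (\int[lebesgue_measure]_(u in `[a', b[) ((b - u) `^ (e - 1))%:E)%E).
  rewrite integral_powR_itvco//; last by rewrite ltrBrDr addrC subrr.
  rewrite subrK lee_fin ler_pdivlMr//.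
  have : (b - a') `^ 1 <= (b - a') `^ e by apply: ger_powR => //; rewrite subr_gt0 a'b.
  rewrite powRr1 ?subr_ge0 ?(ltW a'b)//; apply: le_trans.
  rewrite /e mulrA ler_pdivrMr// mulrC ler_wpM2l ?subr_ge0 ?(ltW a'b)//.
  by rewrite (le_trans (ler_norm r))// lerDl.
have mf q (A : set R) : measurable_fun A (fun u : R => ((b - u) `^ q)%:E).
  by apply/measurable_EFinP; exact: measurable_powR_subl.
apply: (@le_trans _ _ (\int[lebesgue_measure]_(u in `[a', b[) ((b - u) `^ p)%:E)%E).
  apply: ge0_le_integral => //=; try by move=> u _; rewrite lee_fin powR_ge0.
  - exact: mf.
  - exact: mf.
  move=> u; rewrite in_itv/= => /andP[a'u ub]; rewrite lee_fin; apply: ger_powR.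
    by rewrite subr_gt0 ub/= (le_trans _ ba')// lerB.
  by rewrite (le_trans p1)// lerBrDr addrC subrr ltW.
apply: ge0_subset_integral => //=; [exact: mf|by move=> u _; rewrite lee_fin powR_ge0|].
by apply: subset_itvr; rewrite bnd_simp.
Qed.

(** * Asymptotics at infinity: exponents and counting functions *)

Lemma cvgry_powR_exponent0 (R : realType) (K r : R) :
  K * x `^ r @[x --> +oo] --> (1 : R) -> r = 0.
Proof.
move=> h.
(* Comparing x with 2 x gives 2 `^ r = 1. *)
have h2 : K * (2 * x) `^ r @[x --> +oo] --> (1 : R).
  apply: (cvg_comp (fun x : R => 2 * x) (fun x => K * x `^ r) _ h).
  apply/cvgryPge => A; near=> x.
  rewrite -ler_pdivrMl//; near: x; exact: nbhs_pinfty_ge.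
have h3 : 2 `^ r * (K * x `^ r) @[x --> +oo] --> (2 `^ r * 1 : R).
  by apply: cvgM h; exact: cvg_cst.
have : 2 `^ r = 1 :> R.
  rewrite -[LHS]mulr1; apply: (cvg_unique _ h3) => //.
  apply: cvg_trans h2; apply: near_eq_cvg; near=> x.
  by rewrite powRM// 1?mulrCA//; near: x; exact: nbhs_pinfty_ge.
move=> /eqP; rewrite powR_eq1 => /or3P[/eqP||/eqP//]; lra.
Unshelve. all: by end_near. Qed.

(** The second hypothesis makes [s] nondecreasing and [G] its counting function. With k = G y one
    has s (k - 1) <= y < s k, which bounds [y] by means of [G y]; conversely, values of [G] at and
    slightly below [s n] enclose [n]. Each half therefore estimates the reciprocal quotient
    first. *)
Lemma cvg_ratio_counting (R : realType) (s : nat -> R) (G : R -> nat) :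
  (forall n, 0 < s n) -> (forall n y, (s n <= y) = (n < G y)%N) ->
  s n / n.+1%:R @[n --> \oo] --> (1 : R) <->
  (G y)%:R / y @[y --> +oo] --> (1 : R).
Proof.
move=> s0 sG; split=> [h|h].
  suff H : y / (G y)%:R @[y --> +oo] --> (1 : R).
    have -> : (fun y => (G y)%:R / y) = (fun y => (y / (G y)%:R)^-1).
      by apply/funext => y; rewrite invf_div.
    by rewrite -[X in _ --> X]invr1; exact: (cvgV (oner_neq0 R) H).
  apply/cvgrPdist_le => e e0.
  (* The upper bound (1 + e')(k + 1) for [y] exceeds [k] by e' k + 1 + e', three terms that are each
     at most e' k once e' k >= 1. *)
  pose e' := Num.min e 1 / 3.
  have m0 : 0 < Num.min e 1 by rewrite lt_min e0/=.
  have e'0 : 0 < e' by rewrite divr_gt0.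
  have e'e : 3 * e' <= e by rewrite /e' mulrC divfK// ge_min lexx.
  have e'1 : e' <= 1.
    rewrite /e' ler_pdivrMr// mul1r.
    by rewrite (@le_trans _ _ 1) ?ge_min ?lexx ?orbT// ler1n.
  have [n0 _ hn0] := (cvgrPdist_le _ _).1 h _ e'0.
  (* The summand [n0] makes the hypothesis available at k - 1 and [k]; the other one yields 1 <= e'
     k. *)
  pose n1 := (n0 + Num.trunc e'^-1)%N.+1.
  near=> y.
  have kn1 : (n1 < G y)%N.
    by rewrite -sG; near: y; apply: nbhs_pinfty_ge; exact: num_real.
  set k := G y in kn1 *.
  have k0 : 0 < k%:R :> R by rewrite ltr0n (leq_trans _ kn1).
  have up : y < s k by rewrite ltNge sG ltnn.
  have lo : s k.-1 <= y by rewrite sG -/k ltn_predL (leq_trans _ kn1).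
  have k1 : (n0 <= k.-1)%N.
    rewrite -ltnS prednK -?(ltr0n R)//.
    by rewrite (leq_trans _ (ltnW kn1))// ltnS leq_addr.
  have hk : 1 <= e' * k%:R.
    rewrite -ler_pdivrMl// mulr1 ltW// (lt_le_trans (truncnS_gt _))// ler_nat.
    by rewrite (leq_trans _ (ltnW kn1))// ltnS leq_addl.
  have := hn0 _ k1; have := hn0 k (leq_trans k1 (leq_pred _)).
  rewrite prednK -?(ltr0n R)// !ler_distl => /andP[H1 _] /andP[_ H2].
  rewrite lerBlDr ler_pdivrMr ?ltr0n// -natr1 in H1.
  rewrite -lerBlDr ler_pdivlMr// in H2.
  have hk3 : 3 * (e' * k%:R) <= e * k%:R by rewrite mulrA ler_wpM2r// ltW.
  apply/andP; split.
    by rewrite lerBlDr ler_pdivrMr//; nra.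
  by rewrite -lerBlDr ler_pdivlMr//; nra.
suff H : n.+1%:R / s n @[n --> \oo] --> (1 : R).
  have -> : (fun n => s n / n.+1%:R) = (fun n => (n.+1%:R / s n)^-1).
    by apply/funext => n; rewrite invf_div.
  by rewrite -[X in _ --> X]invr1; exact: (cvgV (oner_neq0 R) H).
apply/cvgrPdist_le => e e0.
pose e' := Num.min e 1 / 3.
have m0 : 0 < Num.min e 1 by rewrite lt_min e0/=.
have e'0 : 0 < e' by rewrite divr_gt0.
have e'e : 3 * e' <= e by rewrite /e' mulrC divfK// ge_min lexx.
have e'1 : 3 * e' <= 1 by rewrite /e' mulrC divfK// ge_min lexx orbT.
have [A [_ hA]] := (cvgrPdist_le _ _).1 h _ e'0.
(* The factor 2 absorbs the factor 1 - e' >= 2/3 of [s'] below, so that s n > B implies s' > A. *)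
pose B := Num.max A 0 * 2.
exists (G B) => // n /= Gn.
have sB : B < s n by rewrite ltNge sG -leqNgt.
have AB : A <= Num.max A 0 by rewrite le_max lexx.
have B0 : 0 <= Num.max A 0 by rewrite le_max lexx orbT.
(* G s' <= n < G (s n) because s' < s n, and both counts are estimated by h. *)
pose s' := s n * (1 - e').
have s's : s' < s n by rewrite /s'; have := s0 n; nra.
have As' : A < s' by rewrite /s'; have := s0 n; rewrite /B in sB; nra.
have s'0 : 0 < s' by rewrite mulr_gt0// subr_gt0; lra.
have := hA _ As'; have := hA _ (lt_trans As' s's).
rewrite !ler_distl => /andP[H1 _] /andP[_ H2].
rewrite lerBlDr ler_pdivrMr// in H1.
rewrite -lerBlDr ler_pdivlMr// in H2.
have up : (G s' <= n)%N by rewrite leqNgt -sG -ltNge.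
have lo : (n < G (s n))%N by rewrite -sG.
have {}up : (G s')%:R <= n%:R :> R by rewrite ler_nat.
have {}lo : n.+1%:R <= (G (s n))%:R :> R by rewrite ler_nat.
rewrite -natr1 in lo *.
have sn0 := s0 n.
have he : 3 * (e' * s n) <= e * s n by rewrite mulrA ler_wpM2r// ltW.
apply/andP; split.
  by rewrite lerBlDr ler_pdivrMr//; nra.
(* The lower bound for [n] is (1 - e')^2 s n; its quadratic term only helps. *)
have e's : 0 <= e' * e' * s n by rewrite !mulr_ge0// ltW.
by rewrite -lerBlDr ler_pdivlMr//; rewrite /s' in H2; nra.
Unshelve. all: by end_near. Qed.

(** * Encoded spectra: counting function, density and asymptotics *)

Lemma ler_powR2 (R : realType) (p a b : R) : 0 < p -> 0 <= a -> 0 <= b ->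
  (a `^ p <= b `^ p) = (a <= b).
Proof.
move=> p0 a0 b0; apply/idP/idP; last exact: ge0_ler_powR (ltW p0) _ _ _ _.
by apply: contraTT; rewrite -!ltNge; exact: gt0_ltr_powR.
Qed.

Lemma powRK (R : realType) (p a : R) : p != 0 -> 0 <= a -> (a `^ p) `^ p^-1 = a.
Proof. by move=> p0 a0; rewrite -powRrM mulfV// powRr1. Qed.

Lemma powR_divr (R : realType) (p a b : R) : 0 <= a -> 0 <= b ->
  (a / b) `^ p = a `^ p / b `^ p.
Proof.
by move=> a0 b0; rewrite powRM ?invr_ge0// -(powR_inv1 b0) -powRrM mulN1r powRN.
Qed.

(** By monotonicity the indices counted form an initial segment of the natural numbers, and by
    finiteness a proper one. *)
Lemma enc_counting_fin (R : realType) (C : nat -> R) (x : R) :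
  nonincreasing_seq C -> enc_counting C x \is a fin_num ->
  exists2 k : nat, enc_counting C x = k%:R%:E & forall n, (x <= C n) = (n < k)%N.
Proof.
move=> Cd; rewrite /enc_counting/=.
set A := [set n | _]; rewrite /counting; case: ifPn => //; rewrite asboolE => Af _.
have nA : exists n, ~~ (x <= C n).
  apply: contrapT => /forallNP H; apply: infinite_nat; apply: sub_finite_set Af.
  by move=> n _ /=; apply/negPn/negP; exact: H.
have [k Ak kmin] := ex_minnP nA.
have E n : (x <= C n) = (n < k)%N.
  apply/idP/idP => [xC|nk]; last by apply/negPn/negP => /kmin; rewrite leqNgt nk.
  by rewrite ltnNge; apply: contra Ak => /Cd; exact: le_trans.
exists k => //; suff -> : A = `I_k by rewrite (@card_fset_set _ _ k).
by apply/seteqP; split=> n; rewrite /A /= E.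
Qed.

(** The measure with a unit mass at each [C n], that is, the pushforward of the counting measure
    along [C], is a density. Finite counts allow the cancellation in the extended reals. *)
Lemma encoded_density_exists (R : realType) (C : nat -> R) :
  (forall x, enc_counting C x \is a fin_num) ->
  exists rho : {measure set (measurableTypeR R) -> \bar R}, encoded_density C rho.
Proof.
move=> Cfin.
have mC : @measurable_fun _ _ nat (measurableTypeR R) setT C by [].
exists (measure_function_pushforward__canonical__measure_function_Measure
          (@counting nat R) mC).
split=> // a b ab.
have mI x : measurable ([set n | x <= C n] : set nat) by [].
have E : [set n | b <= C n] `|` C @^-1` `[a, b[%classic = [set n | a <= C n].
  apply/seteqP; split=> n /=; rewrite in_itv/=.
    by case=> [/(le_trans ab)|/andP[]].
  by move=> ->; case: (leP b (C n)) => _; [left|right].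
rewrite /= /pushforward /enc_counting -E measureU//.
  by rewrite addeAC subee ?add0e//; exact: Cfin.
by apply/seteqP; split=> n //= []; rewrite in_itv/= => bC /andP[_]; rewrite ltNge bC.
Qed.

(** No term reaches [pi], so the counting function vanishes there and the mass of [[x, pi[] is the
    full count at [x]. *)
Lemma encoded_density_pi (R : realType) (C : nat -> R)
    (rho : {measure set (measurableTypeR R) -> \bar R}) (x : R) :
  nonincreasing_seq C -> (forall n, C n < pi) -> encoded_density C rho ->
  x < pi ->
  exists2 k : nat, fine (rho `[x, pi[%classic) = k%:R &
    forall n, (x <= C n) = (n < k)%N.
Proof.
move=> Cd Cpi [Cfin rhoE] /ltW xpi; rewrite (rhoE _ _ xpi).
have [k -> kE] := enc_counting_fin Cd (Cfin x).
have [l -> lE] := enc_counting_fin Cd (Cfin pi).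
exists k => //; have -> : l = 0%N; last by rewrite sube0.
by apply/eqP; rewrite eqn0Ngt -lE -ltNge.
Qed.

(** The new quotient is the (d/2)-th power of the old one. Powers are continuous at the limit 1, and
    the inverse exponent 2/d leads back. *)
Lemma encoded_asymptotics_powR (R : realType) (C : nat -> R) (kappa d : R) :
  (forall n, C n < pi) -> 0 < kappa -> 0 < d ->
  encoded_asymptotics C kappa d <->
  ((pi - C n) / kappa) `^ (d / 2) / n.+1%:R @[n --> \oo] --> (1 : R).
Proof.
move=> Cpi k0 d0.
have d2 : 0 < d / 2 by rewrite divr_gt0.
have dd : (2 / d) = (d / 2)^-1 by rewrite invf_div.
have t0 n : 0 < pi - C n by rewrite subr_gt0.
have E n : ((pi - C n) / (kappa * n.+1%:R `^ (2 / d))) `^ (d / 2) =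
           ((pi - C n) / kappa) `^ (d / 2) / n.+1%:R.
  rewrite invfM mulrA [LHS]powR_divr ?powR_ge0// ?divr_ge0 ?(ltW (t0 n)) ?(ltW k0)//.
  by rewrite dd -powRrM mulVf ?gt_eqF// powRr1.
split=> h.
  have := @cvg_powR R nat \oo eventually_filter _ 1 (d / 2) ltr01 h; rewrite powR1.
  move=> H; apply: cvg_trans H; apply: near_eq_cvg; apply: nearW => n.
  by rewrite /= E.
have := @cvg_powR R nat \oo eventually_filter _ 1 (2 / d) ltr01 h; rewrite powR1.
move=> H; apply: cvg_trans H; apply: near_eq_cvg; apply: nearW => n.
rewrite /= -E dd powRK ?gt_eqF//.
by rewrite divr_ge0 ?mulr_ge0 ?powR_ge0 ?(ltW (t0 _)) ?(ltW k0).
Qed.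

Lemma encoded_asymptotics_density (R : realType) (C : nat -> R) (kappa d : R)
    (rho : {measure set (measurableTypeR R) -> \bar R}) :
  nonincreasing_seq C -> (forall n, C n < pi) -> 0 < kappa -> 0 < d ->
  encoded_density C rho ->
  encoded_asymptotics C kappa d <->
  fine (rho `[x, pi[%classic) / ((pi - x) / kappa) `^ (d / 2) @[x --> -oo] --> (1 : R).
Proof.
move=> Cd Cpi k0 d0 Crho.
have d2 : 0 < d / 2 by rewrite divr_gt0.
have t0 n : 0 < (pi - C n) / kappa by rewrite divr_gt0// subr_gt0.
have : forall y, exists k, forall n, (((pi - C n) / kappa) `^ (d / 2) <= y) = (n < k)%N.
  (* For y <= 0 nothing is counted. For y > 0 the count is that of [C] at the point x solving ((pi -
     x) / kappa)^(d/2) = y. *)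
  move=> y; have [y0|y0] := leP y 0.
    by exists 0%N => n; rewrite ltn0 leNgt (le_lt_trans y0)// powR_gt0.
  have yp : pi - kappa * y `^ (d / 2)^-1 < pi.
    by rewrite ltrBlDr ltrDl mulr_gt0// powR_gt0.
  have [k _ kE] := encoded_density_pi Cd Cpi Crho yp.
  exists k => n; rewrite -kE -[in LHS](powRK (invr_neq0 (lt0r_neq0 d2)) (ltW y0)).
  rewrite invrK ler_powR2 ?powR_ge0 ?(ltW (t0 n))//.
  by rewrite ler_pdivrMr// mulrC lerBlDr -lerBlDl.
move=> /choice[G GE].
have rhoG x : x < pi -> fine (rho `[x, pi[%classic) = (G (((pi - x) / kappa) `^ (d / 2)))%:R.
  move=> xpi; have [k -> kE] := encoded_density_pi Cd Cpi Crho xpi.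
  (* Both [k] and the value of [G] are lengths of the same initial segment, hence equal. *)
  have {}kE n : (n < k)%N = (n < G (((pi - x) / kappa) `^ (d / 2)))%N.
    rewrite -kE -GE ler_powR2 ?(ltW (t0 n))// ?divr_ge0 ?subr_ge0 ?(ltW xpi) ?(ltW k0)//.
    by rewrite ler_pM2r ?invr_gt0// lerD2l lerN2.
  move: (G _) kE => g kE; suff -> : k = g by [].
  by apply/eqP; rewrite eqn_leq leqNgt kE ltnn/= leqNgt -kE ltnn.
rewrite encoded_asymptotics_powR// (@cvg_ratio_counting _ _ G) => [|n|n y];
  [|exact: powR_gt0|exact: GE].
split=> h.
  have Yy : ((pi - x) / kappa) `^ (d / 2) @[x --> -oo] --> +oo.
    apply: (cvg_comp (fun x => (pi - x) / kappa) (fun y => y `^ (d / 2)) _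
              (cvgry_powR d2)).
    apply/cvgryPge => A; near=> x.
    rewrite ler_pdivlMr// lerBrDr -lerBrDl.
    by near: x; apply: nbhs_ninfty_le; exact: num_real.
  apply: cvg_trans (cvg_comp _ _ Yy h); apply: near_eq_cvg; near=> x => /=.
  rewrite rhoG//; near: x; apply: nbhs_ninfty_lt; exact: num_real.
(* The inverse of the substitution used for the other direction. *)
have xNy : pi - kappa * y `^ (d / 2)^-1 @[y --> +oo] --> -oo.
  apply/cvgrNyPle => A.
  have d2' : 0 < (d / 2)^-1 by rewrite invr_gt0.
  near=> y; have : (pi - A) / kappa <= y `^ (d / 2)^-1.
    by near: y; exact: (cvgryPge _).1 (cvgry_powR d2') _.
  by rewrite ler_pdivrMr// mulrC lerBlDr -lerBlDl.
apply: cvg_trans (cvg_comp _ _ xNy h); apply: near_eq_cvg; near=> y => /=.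
have y0 : 0 < y by near: y; apply: nbhs_pinfty_gt; exact: num_real.
rewrite rhoG; last by rewrite ltrBlDr ltrDl mulr_gt0// powR_gt0.
rewrite opprB addrC subrK mulrAC mulfV ?gt_eqF// mul1r.
by have := powRK (invr_neq0 (lt0r_neq0 d2)) (ltW y0); rewrite invrK => ->.
Unshelve. all: by end_near. Qed.

(** * Power laws in the Stieltjes sense *)

Lemma integralZl_powR (R : realType) (c a b p : R) : 0 < c ->
  (\int[lebesgue_measure]_(u in `[a, b[) (c * (b - u) `^ p)%:E =
   c%:E * \int[lebesgue_measure]_(u in `[a, b[) ((b - u) `^ p)%:E)%E.
Proof.
move=> c0; under eq_integral do rewrite EFinM.
rewrite ge0_integralZl//.
- by apply/measurable_EFinP; exact: measurable_powR_subl.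
- by move=> u _; rewrite lee_fin powR_ge0.
- by rewrite lee_fin ltW.
Qed.

Lemma Rintegral_powR_itvco (R : realType) (c a b p : R) :
  0 < c -> a < b -> -1 < p ->
  Rintegral lebesgue_measure `[a, b[%classic (fun u => c * (b - u) `^ p) =
  c / (p + 1) * (b - a) `^ (p + 1).
Proof.
move=> c0 ab p1; rewrite /Rintegral integralZl_powR// integral_powR_itvco//=.
by rewrite mulrA mulrAC.
Qed.

(* The integral is +oo, which Rintegral sends to 0. *)
Lemma Rintegral_powR_itvco_diverges (R : realType) (c a b p : R) :
  0 < c -> a < b -> p <= -1 ->
  Rintegral lebesgue_measure `[a, b[%classic (fun u => c * (b - u) `^ p) = 0.
Proof.
move=> c0 ab p1; rewrite /Rintegral integralZl_powR// integral_powR_itvco_pinfty//.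
by rewrite gt0_muley ?lte_fin.
Qed.

(** For p <= -1 the [Rintegral] is 0 and, with [0^-1 = 0], the quotient is eventually constant 0, so
    it cannot tend to 1. Otherwise the integral has its closed form for x < pi. *)
Lemma stieltjes_equiv_powR (R : realType) (c p : R)
    (rho : {measure set (measurableTypeR R) -> \bar R}) : 0 < c ->
  stieltjes_equiv rho (fun x => c * (pi - x) `^ p) <->
  -1 < p /\ fine (rho `[x, pi[%classic) / (c / (p + 1) * (pi - x) `^ (p + 1))
    @[x --> -oo] --> (1 : R).
Proof.
move=> c0; rewrite /stieltjes_equiv.
have ltpi : \forall x \near -oo, x < pi :> R.
  by apply: nbhs_ninfty_lt; exact: num_real.
split=> [h|[p1 h]]; last first.
  apply: cvg_trans h; apply: near_eq_cvg; near=> x.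
  by rewrite Rintegral_powR_itvco//; near: x.
have p1 : -1 < p.
  rewrite ltNge; apply/negP => p1.
  suff : (1 : R) = 0 by move/eqP; rewrite oner_eq0.
  apply: (cvg_unique _ h) => //.
  apply: (@cvg_trans _ (cst 0 @ (-oo : set_system R))); last exact: cvg_cst.
  apply: near_eq_cvg; near=> x.
  by rewrite Rintegral_powR_itvco_diverges ?invr0 ?mulr0//; near: x.
split=> //; apply: cvg_trans h; apply: near_eq_cvg; near=> x.
by rewrite Rintegral_powR_itvco//; near: x.
Unshelve. all: by end_near. Qed.

(** The relation between [c] and [kappa] makes the integral of the law over [[x, pi[] equal to ((pi
    - x) / kappa)^(d/2). It is kept as an equation so that it can be solved for either constant. *)
Lemma encoded_asymptotics_stieltjes (R : realType) (C : nat -> R) (kappa c d : R)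
    (rho : {measure set (measurableTypeR R) -> \bar R}) :
  nonincreasing_seq C -> (forall n, C n < pi) -> 0 < kappa -> 0 < d ->
  c = d / 2 * kappa `^ (- (d / 2)) ->
  encoded_density C rho ->
  encoded_asymptotics C kappa d <->
  stieltjes_equiv rho (fun x => c * (pi - x) `^ ((d - 2) / 2)).
Proof.
move=> Cd Cpi k0 d0 cE Crho.
have d2 : 0 < d / 2 by rewrite divr_gt0.
have p1 : (d - 2) / 2 + 1 = d / 2 by field.
have c0 : 0 < c by rewrite cE mulr_gt0// powR_gt0.
rewrite (encoded_asymptotics_density Cd Cpi k0 d0 Crho) stieltjes_equiv_powR// p1.
have E : \forall x \near -oo,
    ((pi - x) / kappa) `^ (d / 2) = c / (d / 2) * (pi - x) `^ (d / 2).
  near=> x.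
  have xpi : x < pi by near: x; apply: nbhs_ninfty_lt; exact: num_real.
  rewrite powR_divr ?subr_ge0 ?(ltW xpi) ?(ltW k0)// cE powRN mulrC.
  by congr (_ * _); rewrite mulrAC mulfV ?gt_eqF// mul1r.
split=> [h|[_ h]].
  split; first by lra.
  by apply: cvg_trans h; apply: near_eq_cvg; apply: filterS E => x /= ->.
by apply: cvg_trans h; apply: near_eq_cvg; apply: filterS E => x /= ->.
Unshelve. all: by end_near. Qed.

(** Dividing one limit by the other cancels the mass of [rho] and leaves K y^(q - p) --> 1 with y =
    pi - x, which forces q = p. *)
Lemma stieltjes_equiv_exponent (R : realType) (c c' p q : R)
    (rho : {measure set (measurableTypeR R) -> \bar R}) : 0 < c -> 0 < c' ->
  stieltjes_equiv rho (fun x => c * (pi - x) `^ p) ->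
  stieltjes_equiv rho (fun x => c' * (pi - x) `^ q) -> p = q.
Proof.
move=> c0 c'0 /(stieltjes_equiv_powR _ _ c0)[p1 hp] /(stieltjes_equiv_powR _ _ c'0)[q1 hq].
have p0 : 0 < p + 1 by rewrite -ltrBlDr sub0r.
have q0 : 0 < q + 1 by rewrite -ltrBlDr sub0r.
suff : q - p = 0 by move/subr0_eq.
pose K := (c' / (q + 1)) / (c / (p + 1)).
apply: (@cvgry_powR_exponent0 _ K).
set f := (X in X @ _ --> _) in hp; set g := (X in X @ _ --> _) in hq.
have H : f x / g x @[x --> -oo] --> (1 / 1 : R).
  by apply: cvgM hp _; exact: cvgV (oner_neq0 R) hq.
rewrite divr1 {}/f {}/g in H hp hq.
have xNy : pi - y @[y --> +oo] --> (-oo : set_system R).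
  apply/cvgrNyPle => A; near=> y.
  by rewrite lerBlDr -lerBlDl; near: y; apply: nbhs_pinfty_ge; exact: num_real.
(* The mass can be cancelled only where it is nonzero; this holds eventually, since a zero mass
   would put the quotient at distance 1 from its limit. *)
have nz : \forall x \near -oo, fine (rho `[x, pi[%classic) != 0.
  near=> x; apply/eqP => r0.
  suff : `|1 - fine (rho `[x, pi[%classic) / (c / (p + 1) * (pi - x) `^ (p + 1))| < 1.
    by rewrite r0 mul0r subr0 normr1 ltxx.
  by near: x; exact: (cvgrPdist_lt _ _).1 hp _ ltr01.
have nz' : \forall y \near +oo, fine (rho `[pi - y, pi[%classic) != 0 by exact: xNy nz.
apply: cvg_trans (cvg_comp _ _ xNy H); apply: near_eq_cvg; near=> y => /=.
have y0 : 0 < y by near: y; apply: nbhs_pinfty_gt; exact: num_real.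
have r0 : fine (rho `[pi - y, pi[%classic) != 0 by near: y.
have -> : pi - (pi - y) = y by ring.
have -> : q - p = (q + 1) - (p + 1) by ring.
rewrite powRB ?(gt_eqF y0) ?implybT// /K.
have Pp := powR_gt0 (p + 1) y0; have Pq := powR_gt0 (q + 1) y0.
by field; rewrite r0 !gt_eqF.
Unshelve. all: by end_near. Qed.

(** * Finiteness of the counts, and assembly of the theorem *)

Lemma encoded_asymptotics_fin_num (R : realType) (C : nat -> R) (kappa d : R) :
  (forall n, C n < pi) -> 0 < kappa -> 0 < d ->
  encoded_asymptotics C kappa d -> forall x, enc_counting C x \is a fin_num.
Proof.
move=> Cpi k0 d0 h x.
have d2 : 0 < 2 / d by rewrite divr_gt0.
have u n : 0 < kappa * n.+1%:R `^ (2 / d) by rewrite mulr_gt0// powR_gt0.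
have ny : n.+1%:R `^ (2 / d) @[n --> \oo] --> (+oo : set_system R).
  apply: (cvg_comp _ (fun y : R => y `^ (2 / d)) _ (cvgry_powR d2)).
  rewrite (cvg_shiftS (fun n => n%:R : R)); exact: cvgr_idn.
have [N _ hN] : \forall n \near \oo, C n < x.
  (* Writing u for kappa (n + 1)^(2/d), eventually pi - C n > u / 2 > pi - x. *)
  near=> n.
  have H1 : `|1 - (pi - C n) / (kappa * n.+1%:R `^ (2 / d))| < 2^-1.
    by near: n; apply: ((cvgrPdist_lt _ _).1 h); rewrite invr_gt0.
  have H2 : 2 * (pi - x) / kappa < n.+1%:R `^ (2 / d).
    by near: n; exact: (cvgryPgt _).1 ny _.
  rewrite ltr_pdivrMr// [X in _ < X]mulrC in H2.
  rewrite ltr_distl in H1; case/andP: H1 => _.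
  rewrite -ltrBlDr ltr_pdivlMr//; have := u n; lra.
rewrite /enc_counting /counting asboolT//.
apply: sub_finite_set (finite_II N) => n /= xC; rewrite ltnNge; apply/negP => /hN.
by rewrite /= ltNge xC.
Unshelve. all: by end_near. Qed.

Lemma encoded_nonincreasing (R : realType) (eps : R) (lam : nat -> R) : 0 < eps ->
  nondecreasing_seq lam -> nonincreasing_seq (encoded eps lam).
Proof. by move=> e0 lam_nd m n mn; rewrite lerD2l lerN2 ler_pM2l// lam_nd. Qed.

Theorem theorem8 (R : realType) :
  (* density law for encoded manifold spectra *)
  (forall (m : nat) (M : closedRiemannianManifold R m)
          (eps : R) (lam : nat -> R) (kappa d : R),
     0 < eps -> positive_laplace_spectrum M lam ->
     (forall n, encoded eps lam n < pi) ->
     0 < kappa -> 0 < d ->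
     encoded_asymptotics (encoded eps lam) kappa d ->
     exists rho : {measure set (measurableTypeR R) -> \bar R},
       encoded_density (encoded eps lam) rho /\ power_law rho ((d - 2) / 2))
  /\
  (* the exponent of the law determines d *)
  (forall (eps : R) (lam : nat -> R) (kappa d : R)
          (rho : {measure set (measurableTypeR R) -> \bar R}) (alpha : R),
     0 < eps -> nondecreasing_seq lam ->
     (forall n, encoded eps lam n < pi) ->
     0 < kappa -> 0 < d ->
     encoded_asymptotics (encoded eps lam) kappa d ->
     encoded_density (encoded eps lam) rho ->
     power_law rho alpha ->
     d = 2 * alpha + 2)
  /\
  (* converse *)
  (forall (eps : R) (lam : nat -> R) (d : R)
          (rho : {measure set (measurableTypeR R) -> \bar R}),
     0 < eps -> nondecreasing_seq lam ->
     (forall n, encoded eps lam n < pi) ->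
     0 < d ->
     encoded_density (encoded eps lam) rho ->
     power_law rho ((d - 2) / 2) ->
     exists2 kappa' : R, 0 < kappa' &
       encoded_asymptotics (encoded eps lam) kappa' d).

Proof.
split; [|split].
- move=> m M eps lam kappa d eps0 [lam_nd _ _] Cpi k0 d0 h.
  have Cd := encoded_nonincreasing eps0 lam_nd.
  have [rho Crho] := encoded_density_exists (encoded_asymptotics_fin_num Cpi k0 d0 h).
  exists rho; split => //; exists (d / 2 * kappa `^ (- (d / 2))).
    by rewrite mulr_gt0 ?divr_gt0// powR_gt0.
  exact: (encoded_asymptotics_stieltjes Cd Cpi k0 d0 erefl Crho).1 h.
- move=> eps lam kappa d rho alpha eps0 lam_nd Cpi k0 d0 h Crho [c c0 rhoc].
  have Cd := encoded_nonincreasing eps0 lam_nd.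
  (* The asymptotics give [rho] a second law, of exponent (d - 2)/2, with which [alpha] must
     agree. *)
  have := (encoded_asymptotics_stieltjes Cd Cpi k0 d0 erefl Crho).1 h.
  have c'0 : 0 < d / 2 * kappa `^ (- (d / 2)) by rewrite mulr_gt0 ?divr_gt0// powR_gt0.
  by move/(stieltjes_equiv_exponent c0 c'0 rhoc) => ->; field.
move=> eps lam d rho eps0 lam_nd Cpi d0 Crho [c c0 rhoc].
have Cd := encoded_nonincreasing eps0 lam_nd.
have d2 : 0 < d / 2 by rewrite divr_gt0.
have cd : 0 < c / (d / 2) by rewrite divr_gt0.
(* This is the solution kappa' of c = d/2 * kappa'^(-d/2). *)
have k0 : 0 < (c / (d / 2)) `^ (- (d / 2))^-1 by exact: powR_gt0.
exists ((c / (d / 2)) `^ (- (d / 2))^-1) => //.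
apply: (encoded_asymptotics_stieltjes Cd Cpi k0 d0 _ Crho).2 rhoc.
have dN : - (d / 2) != 0 by rewrite oppr_eq0 gt_eqF.
have := powRK (invr_neq0 dN) (ltW cd); rewrite invrK => ->.
by rewrite mulrC divfK// gt_eqF.
Qed.
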